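(* Let $\mathbf{S} = (\mathbf{L}, \mathbf{def})$ be a shapes schema and let $\mathbf{G}$ be an RDF graph. Let $\mathit{strat}_1$ and $\mathit{strat}_2$ be two stratifications of $\mathbf{S}$. Then $\mathit{Typing}(\mathbf{G}, \mathbf{S}, \mathit{strat}_1) = \mathit{Typing}(\mathbf{G}, \mathbf{S}, \mathit{strat}_2)$.
   Context: **RDF graphs.** Let $\mathsf{IRI}$, $\mathsf{Lit}$, $\mathsf{Blank}$ be three pairwise disjoint sets (IRIs, literals, blank nodes). An RDF graph $\mathbf{G}$ is a set of triples $(s,p,o) \in (\mathsf{IRI} \cup \mathsf{Blank}) \times \mathsf{IRI} \times (\mathsf{IRI} \cup \mathsf{Lit} \cup \mathsf{Blank})$. $\mathrm{Nodes}(\mathbf{G})$ is the set of elements occurring as subject ($s$) or object ($o$) of some triple of $\mathbf{G}$. The neighbourhood of a node $n$ is $\mathit{neigh}(n) = \{(s,p,o) \in \mathbf{G} \mid s = n\}$. $N = N_1 \uplus N_2$ means $N = N_1 \cup N_2$ and $N_1 \cap N_2 = \emptyset$ (similarly for $k$ pairwise disjoint sets). **Shapes schemas.** A shapes schema is a pair $\mathbf{S} = (\mathbf{L}, \mathbf{def})$, where $\mathbf{L}$ is a set of shape labels and $\mathbf{def}$ maps every label of $\mathbf{L}$ to a shape expression. Let $\_b$ be a special constant. Shape expressions are given by $S ::= V \mid E \mid S \;\mathsf{AND}\; S \mid S \;\mathsf{OR}\; S \mid \mathsf{NOT}\; S$, where $V$ (a value description) is a subset of $\mathsf{IRI} \cup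 \mathsf{Lit} \cup \{\_b\}$ and $E$ (a neighbourhood description) is a triple expression. Triple expressions are given by $E ::= P\,@L \mid \mathsf{EMPTY} \mid (E \mid E) \mid E\,;E \mid E[\mathit{min};\mathit{max}]$, where $P \subseteq \mathsf{IRI}$, $L \in \mathbf{L}$, $\mathit{min}$ is a natural number and $\mathit{max}$ is a natural number or $*$ (unbounded). Standing assumption: all shape expressions $\mathbf{def}(L)$ are in disjunctive normal form; in particular $\mathsf{NOT}$ is applied only to atomic sub-expressions (value descriptions or triple expressions). **Typings and satisfaction.** A typing of $\mathbf{G}$ by $\mathbf{S}$ is a subset of $\mathrm{Nodes}(\mathbf{G}) \times \mathbf{L}$. For a typing $t$ and a finite or infinite set of triples $N$, the relation $t, N \vDash E$ is defined recursively on $E$: - $t, N \vDash P@L$ iff $N = \{(s,p,o)\}$ is a singleton with $p \in P$ and $(o,L) \in t$; - $t, N \vDash \mathsf{EMPTY}$ iff $N = \emptyset$; - $t, N \vDash E_1 \mid E_2$ iff $t,N \vDash E_1$ or $t,N \vDash E_2$; - $t, N \vDash E_1 ; E_2$ iff $N = N_1 \uplus N_2$ for some $N_1, N_2$ with $t,N_1 \vDash E_1$ and $t,N_2 \vDash E_2$; - $t, N \vDash E[\mathit{min};\mathit{max}]$ iff for some natural $k$ with $\mathit{min} \le k \le \mathit{max}$ (no upper bound if $\mathit{max} = *$), $N = N_1 \uplus \dots \uplus N_k$ with $t, N_j \vDash E$ for all $1 \le j \le k$ ($k=0$ being possible only when $N = \emptyset$). For a node $n$, the relation $t, n \vdash S$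 is defined recursively on $S$: - $t, n \vdash V$ iff $n \in V$, or $n \in \mathsf{Blank}$ and $\_b \in V$; - $t, n \vdash E$ iff $t, \mathit{neigh}(n) \vDash E$; - $\mathsf{AND}$ and $\mathsf{OR}$ are interpreted as conjunction and disjunction; - $t, n \vdash \mathsf{NOT}\,S$ iff not $t, n \vdash S$. A typing $t$ is a *correct typing* of $\mathbf{G}$ by $\mathbf{S}$ if $t, n \vdash \mathbf{def}(L)$ for every $(n,L) \in t$. **Stratification.** For labels $L_1, L_2$: $\mathit{dep}^-(L_1,L_2)$ holds iff $L_2$ appears in $\mathbf{def}(L_1)$ under an occurrence of $\mathsf{NOT}$; $\mathit{dep}^+(L_1,L_2)$ holds iff $L_2$ appears in $\mathbf{def}(L_1)$ but never under an occurrence of $\mathsf{NOT}$. A stratification of $\mathbf{S}$ with $k$ strata ($k \ge 1$) is a map $\mathit{strat} : \mathbf{L} \to [1;k]$ such that $\mathit{dep}^-(L_1,L_2)$ implies $\mathit{strat}(L_1) > \mathit{strat}(L_2)$, and $\mathit{dep}^+(L_1,L_2)$ implies $\mathit{strat}(L_1) \ge \mathit{strat}(L_2)$. (Two stratifications may have different numbers of strata.) **Stratification-maximal typing.** Given a stratification $\mathit{strat}$ with $k$ strata, for $1 \le i \le k$ let $\mathbf{L}_i = \{L \in \mathbf{L} \mid \mathit{strat}(L) \le i\}$ and let $\mathbf{S}_i = (\mathbf{L}_i, \mathbf{def}_i)$ with $\mathbf{def}_i$ the restriction of $\mathbf{def}$ to $\mathbf{L}_i$. For a typing $t$, let $t_{|\mathbf{L}_i}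 = \{(n,L) \in t \mid L \in \mathbf{L}_i\}$. Define $\mathit{typing}_1$ as the maximal correct typing of $\mathbf{G}$ by $\mathbf{S}_1$, i.e. the union of all correct typings of $\mathbf{G}$ by $\mathbf{S}_1$; and for $1 \le i < k$, $\mathit{typing}_{i+1}$ as the union of all correct typings $t'$ of $\mathbf{G}$ by $\mathbf{S}_{i+1}$ such that $t'_{|\mathbf{L}_i} = \mathit{typing}_i$. Then $\mathit{Typing}(\mathbf{G},\mathbf{S},\mathit{strat}) = \mathit{typing}_k$. *)

(* Defs.v *)
From mathcomp Require Import all_boot.
From mathcomp Require Import classical_sets.

Set Implicit Arguments.
Unset Strict Implicit.
Unset Printing Implicit Defensive.

Local Open Scope classical_set_scope.

Section Shapes.
(* [IRI], [Lit] and [Blank] are kept disjoint by the constructors below.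
   [Label] is an ambient type of labels, of which a schema uses the subset
   [labels S]. *)
Variables (IRI Lit Blank Label : Type).

Inductive node := Iri of IRI | Literal of Lit | BlankNode of Blank.

(* Literals are not allowed in subject position. *)
Inductive subject := SubjIri of IRI | SubjBlank of Blank.

Definition node_of_subject (s : subject) : node :=
  match s with SubjIri i => Iri i | SubjBlank b => BlankNode b end.

Record triple := Triple { subj : subject; predicate : IRI; obj : node }.

Definition graph := set triple.

Definition Nodes (G : graph) : set node :=
  [set n | exists2 tr, G tr & n = node_of_subject (subj tr) \/ n = obj tr].

Definition neigh (G : graph) (n : node) : set triple :=
  [set tr | G tr /\ node_of_subject (subj tr) = n].

(* [ConstBlank] is the special constant _b. *)
Inductive const := ConstIri of IRI | ConstLit of Lit | ConstBlank.

(* In [Repeat E min max], [max = None] stands for the unbounded *. *)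
Inductive triple_expr :=
  | Arc of set IRI & Label
  | Empty
  | Choice of triple_expr & triple_expr
  | Group of triple_expr & triple_expr
  | Repeat of triple_expr & nat & option nat.

Inductive shape_expr :=
  | Value of set const
  | Neigh of triple_expr
  | And of shape_expr & shape_expr
  | Or of shape_expr & shape_expr
  | Not of shape_expr.

Fixpoint te_labels (E : triple_expr) : set Label :=
  match E with
  | Arc _ L => [set L]
  | Empty => set0
  | Choice E1 E2 | Group E1 E2 => te_labels E1 `|` te_labels E2
  | Repeat E1 _ _ => te_labels E1
  end.

Fixpoint se_labels (S : shape_expr) : set Label :=
  match S with
  | Value _ => set0
  | Neigh E => te_labels E
  | And S1 S2 | Or S1 S2 => se_labels S1 `|` se_labels S2
  | Not S1 => se_labels S1
  end.

(* The labels with at least one occurrence under a [Not]. *)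
Fixpoint negated_labels (S : shape_expr) : set Label :=
  match S with
  | Value _ | Neigh _ => set0
  | And S1 S2 | Or S1 S2 => negated_labels S1 `|` negated_labels S2
  | Not S1 => se_labels S1
  end.

Definition atomic (S : shape_expr) : bool :=
  match S with Value _ | Neigh _ => true | _ => false end.

(* An atomic expression or its negation. *)
Definition signed_atom (S : shape_expr) : bool :=
  match S with Not S1 => atomic S1 | _ => atomic S end.

Fixpoint conj_form (S : shape_expr) : bool :=
  match S with
  | And S1 S2 => conj_form S1 && conj_form S2
  | _ => signed_atom S
  end.

Fixpoint dnf (S : shape_expr) : bool :=
  match S with
  | Or S1 S2 => dnf S1 && dnf S2
  | _ => conj_form S
  end.

(* [def] is total on [Label]; its values outside [labels] are never used, so
   that restricting a schema only changes [labels]. *)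
Record schema := Schema { labels : set Label; def : Label -> shape_expr }.

Definition valid_schema (S : schema) : Prop :=
  forall L, labels S L -> se_labels (def S L) `<=` labels S /\ dnf (def S L).

Definition typing := set (node * Label).

Definition is_typing (G : graph) (S : schema) (t : typing) : Prop :=
  t `<=` Nodes G `*` labels S.

Definition in_bounds (min : nat) (max : option nat) (k : nat) : bool :=
  (min <= k) && (if max is Some m then k <= m else true).

Fixpoint te_sat (t : typing) (N : set triple) (E : triple_expr) : Prop :=
  match E with
  | Arc P L => exists s p o, [/\ N = [set Triple s p o], P p & t (o, L)]
  | Empty => N = set0
  | Choice E1 E2 => te_sat t N E1 \/ te_sat t N E2
  | Group E1 E2 => exists N1 N2,
      [/\ N = N1 `|` N2, N1 `&` N2 = set0, te_sat t N1 E1 & te_sat t N2 E2]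
  | Repeat E1 min max => exists k (Ns : 'I_k -> set triple),
      [/\ in_bounds min max k, N = \bigcup_j Ns j, trivIset setT Ns
        & forall j, te_sat t (Ns j) E1]
  end.

Definition value_sat (n : node) (V : set const) : Prop :=
  match n with
  | Iri i => V (ConstIri i)
  | Literal l => V (ConstLit l)
  | BlankNode _ => V ConstBlank
  end.

Fixpoint se_sat (G : graph) (t : typing) (n : node) (S : shape_expr) : Prop :=
  match S with
  | Value V => value_sat n V
  | Neigh E => te_sat t (neigh G n) E
  | And S1 S2 => se_sat G t n S1 /\ se_sat G t n S2
  | Or S1 S2 => se_sat G t n S1 \/ se_sat G t n S2
  | Not S1 => ~ se_sat G t n S1
  end.

Definition correct_typing (G : graph) (S : schema) (t : typing) : Prop :=
  is_typing G S t /\ forall n L, t (n, L) -> se_sat G t n (def S L).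

Definition dep_neg (S : schema) (L1 L2 : Label) : Prop :=
  negated_labels (def S L1) L2.

Definition dep_pos (S : schema) (L1 L2 : Label) : Prop :=
  se_labels (def S L1) L2 /\ ~ negated_labels (def S L1) L2.

Record stratification (S : schema) := Stratification {
  nstrata : nat;
  strat : Label -> nat;
  nstrata_gt0 : 1 <= nstrata;
  strat_range : forall L, labels S L -> 1 <= strat L <= nstrata;
  strat_neg : forall L1 L2, labels S L1 -> labels S L2 ->
    dep_neg S L1 L2 -> strat L1 > strat L2;
  strat_pos : forall L1 L2, labels S L1 -> labels S L2 ->
    dep_pos S L1 L2 -> strat L1 >= strat L2
}.

Definition strata_upto (S : schema) (st : stratification S) (i : nat) :
    set Label :=
  [set L | labels S L /\ strat st L <= i].

Definition restrict_schema (S : schema) (st : stratification S) (i : nat) :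
    schema :=
  Schema (strata_upto st i) (def S).

Definition restrict_typing (t : typing) (Ls : set Label) : typing :=
  [set nL | t nL /\ Ls nL.2].

(* Strata are numbered from 1; the value at 0 is a dummy, used nowhere. *)
Fixpoint stratum_typing (G : graph) (S : schema) (st : stratification S)
    (i : nat) : typing :=
  match i with
  | 0 => set0
  | j.+1 =>
    if j == 0 then
      \bigcup_(t in correct_typing G (restrict_schema st 1)) t
    else
      \bigcup_(t in [set t | correct_typing G (restrict_schema st j.+1) t /\
        restrict_typing t (strata_upto st j) = stratum_typing G st j]) t
  end.

Definition Typing (G : graph) (S : schema) (st : stratification S) : typing :=
  stratum_typing G st (nstrata st).

End Shapes.

(* Main.v *)
Require Import Defs.
From mathcomp Require Import all_boot.
From mathcomp Require Import boolp classical_sets.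

(** Satisfaction of a shape expression is monotone in the typing as long as the
    typing is not changed on the negated labels. Hence the typing of every
    stratum is itself correct, and [Typing G st] is maximal stratum by stratum.
    Given two stratifications, the two typings are shown to agree on a label
    [L] by induction on [strat st1 L + strat st2 L]: the set [A] of labels lying
    no higher than [L] in both stratifications is closed under dependencies,
    and by induction the typings agree on the members of [A] lying strictly
    below [L] in one of the stratifications. So the restriction to [A] of each
    typing can be added to the other one, and maximality absorbs it. *)

Set Implicit Arguments.
Unset Strict Implicit.
Unset Printing Implicit Defensive.

Local Open Scope classical_set_scope.

(** * Monotonicity of satisfaction *)

Section Satisfaction.
Variables (IRI Lit Blank Label : Type).
Implicit Types (t : typing IRI Lit Blank Label) (S : schema IRI Lit Label).
Implicit Types (G : graph IRI Lit Blank) (A B : set Label).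

Lemma te_sat_mono t t' N (E : triple_expr IRI Label) :
  (forall n L, te_labels E L -> t (n, L) -> t' (n, L)) ->
  te_sat t N E -> te_sat t' N E.
Proof.
elim: E N => [P L|//|E1 IH1 E2 IH2|E1 IH1 E2 IH2|E IH m M] N /= tt'.
- by case=> s [p [o [-> Pp toL]]]; exists s, p, o; split=> //; exact: tt'.
- case=> [/IH1|/IH2] H; [left|right]; apply: H => n L EL; apply: tt'.
    by left.
  by right.
- case=> N1 [N2 [-> N12 /IH1 H1 /IH2 H2]]; exists N1, N2; split=> //.
    by apply: H1 => n L EL; apply: tt'; left.
  by apply: H2 => n L EL; apply: tt'; right.
- by case=> k [Ns [kb -> dis H]]; exists k, Ns; split=> // j; exact: IH.
Qed.

Lemma negated_labels_sub (e : shape_expr IRI Lit Label) :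
  negated_labels e `<=` se_labels e.
Proof.
elim: e => /= [V|E|e1 IH1 e2 IH2|e1 IH1 e2 IH2|e _].
- exact: sub0set.
- exact: sub0set.
- exact: setUSS.
- exact: setUSS.
- exact: subset_refl.
Qed.

Lemma se_sat_mono G t t' n (e : shape_expr IRI Lit Label) :
  (forall m L, se_labels e L -> t (m, L) -> t' (m, L)) ->
  (forall m L, negated_labels e L -> t' (m, L) -> t (m, L)) ->
  se_sat G t n e -> se_sat G t' n e.
Proof.
elim: e t t' => [//|E|e1 IH1 e2 IH2|e1 IH1 e2 IH2|e IH] t t' /= tt' t't.
- exact: te_sat_mono.
- case=> H1 H2; split.
    by apply: IH1 H1 => m L eL; [apply: tt'|apply: t't]; left.
  by apply: IH2 H2 => m L eL; [apply: tt'|apply: t't]; right.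
- case=> H; [left|right].
    by apply: IH1 H => m L eL; [apply: tt'|apply: t't]; left.
  by apply: IH2 H => m L eL; [apply: tt'|apply: t't]; right.
(* The induction hypothesis is used with [t] and [t'] exchanged: every label of [e] is negated in
   [Not e], so both inclusions are available. *)
- move=> nH H; apply: nH; apply: IH H => // m L /negated_labels_sub.
  exact: tt'.
Qed.

(** On the labels negated in a definition that a member relies on, the union adds nothing to that
    member, so [se_sat_mono] carries satisfaction from the member to the union. *)
Lemma bigcup_correct_typing G S (F : set (typing IRI Lit Blank Label)) :
  (forall t, F t -> correct_typing G S t) ->
  (forall t n L m L', F t -> t (n, L) -> negated_labels (def S L) L' ->
     (\bigcup_(u in F) u) (m, L') -> t (m, L')) ->
  correct_typing G S (\bigcup_(t in F) t).
Proof.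
move=> Fc Fneg; split=> [nL [t /Fc [tS _]]|n L [t Ft tnL]]; first exact: tS.
apply: se_sat_mono (proj2 (Fc _ Ft) _ _ tnL) => m L'; first by exists t.
exact: Fneg Ft tnL.
Qed.

(** As [A] is closed under dependencies, the restriction leaves [t] unchanged on every label that a
    definition of a label of [A] mentions. *)
Lemma restrict_correct_typing G S t A B :
  A `<=` B -> (forall L, A L -> se_labels (def S L) `<=` A) ->
  correct_typing G S t ->
  correct_typing G (Schema B (def S)) (restrict_typing t A).
Proof.
move=> AB Acl [tS tsat]; split=> [nL [tnL AL]|n L [tnL AL]].
  by have [GnL _] := tS _ tnL; split=> //; exact: AB.
apply: se_sat_mono (tsat _ _ tnL) => m L' eL'; last by case.
by split=> //; exact: Acl eL'.
Qed.

End Satisfaction.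

(** * Stratum typings of a single stratification *)

Section Strata.
Variables (IRI Lit Blank Label : Type).
Variables (G : graph IRI Lit Blank) (S : schema IRI Lit Label).
Hypothesis hS : valid_schema S.
Variable st : stratification S.

Lemma strat_negated L L' : labels S L -> negated_labels (def S L) L' ->
  labels S L' /\ strat st L' < strat st L.
Proof.
move=> SL eL'; have SL' : labels S L'.
  by apply: (proj1 (hS SL)); exact: negated_labels_sub.
by split=> //; exact: strat_neg.
Qed.

Lemma strat_se_labels L L' : labels S L -> se_labels (def S L) L' ->
  labels S L' /\ strat st L' <= strat st L.
Proof.
move=> SL eL'; have SL' : labels S L' by exact: (proj1 (hS SL)).
split=> //; have [nL'|nL'] := EM (negated_labels (def S L) L').
  by apply: ltnW; exact: strat_neg.
exact: strat_pos.
Qed.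

Lemma strata_upto_closed i L : strata_upto st i L ->
  se_labels (def S L) `<=` strata_upto st i.
Proof.
move=> [SL Li] L' /(strat_se_labels SL) [SL' L'L].
by split=> //; exact: leq_trans Li.
Qed.

(** Makes the first stratum an instance of the general step: no label has stratum 0, so for [i = 0]
    the constraint reads [set0 = set0]. *)
Lemma stratum_typingS i : stratum_typing G st i.+1 =
  \bigcup_(t in [set t | correct_typing G (restrict_schema st i.+1) t /\
    restrict_typing t (strata_upto st i) = stratum_typing G st i]) t.
Proof.
case: i => [|//] /=; apply: eq_bigcupl; split=> t; last by case.
move=> ct; split=> //; apply/seteqP; split=> // nL [_ [SL]].
by case/andP: (strat_range st SL) => L1 _; rewrite leqNgt L1.
Qed.

Lemma stratum_typing_correct i :
  correct_typing G (restrict_schema st i) (stratum_typing G st i) /\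
  restrict_typing (stratum_typing G st i.+1) (strata_upto st i)
    = stratum_typing G st i.
Proof.
elim: i => [|i [IHc IHr]].
  split; first by split.
  apply/seteqP; split=> // nL [_ [SL]].
  by case/andP: (strat_range st SL) => L1 _; rewrite leqNgt L1.
have ci : correct_typing G (restrict_schema st i.+1) (stratum_typing G st i.+1).
  rewrite stratum_typingS; apply: bigcup_correct_typing => [t [] //|].
  move=> t n L m L' [tc ti] tnL nL' [u [uc ui] umL'].
  have [_ [SL Li]] := proj1 tc _ tnL.
  have [SL' L'L] := strat_negated SL nL'.
  (* A negated label has stratum at most [i], where all candidates coincide with
     [stratum_typing G st i]. *)
  have: stratum_typing G st i (m, L').
    rewrite -ui; split=> //; split=> //.
    by rewrite -ltnS; exact: leq_trans L'L Li.
  by rewrite -ti => -[].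
split=> //; rewrite (stratum_typingS i.+1).
apply/seteqP; split=> [nL [[t [_ <-] tnL] Li] //|nL inL].
have [_ Li] := proj1 ci _ inL; split=> //.
(* The typing of stratum [i.+1] is itself a candidate for stratum [i.+2]. *)
exists (stratum_typing G st i.+1) => //; split.
  split=> [mL imL|]; last exact: (proj2 ci).
  have [GmL [SmL mLi]] := proj1 ci _ imL.
  by split=> //; split=> //; exact: leqW.
apply/seteqP; split=> [mL []//|mL imL]; split=> //.
by have [] := proj1 ci _ imL.
Qed.

Lemma restrict_stratum_typing i k : i <= k ->
  restrict_typing (stratum_typing G st k) (strata_upto st i)
    = stratum_typing G st i.
Proof.
move=> /subnK <-; elim: (k - i) => [|d IH].
  have [[iS _] _] := stratum_typing_correct i.
  by apply/seteqP; split=> [nL []//|nL inL]; split=> //; have [] := iS _ inL.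
rewrite -[RHS]IH addSn -(proj2 (stratum_typing_correct (d + i))).
apply/seteqP; split=> nL; last by case=> -[].
move=> [tnL [SL Li]]; split=> //; split=> //; split=> //.
exact: leq_trans (leq_addl _ _).
Qed.

Lemma Typing_correct : correct_typing G S (Typing G st).
Proof.
have [[tS tsat] _] := stratum_typing_correct (nstrata st); split=> //.
by move=> nL /tS [GnL []].
Qed.

Lemma Typing_maximal t A i : i < nstrata st -> A `<=` strata_upto st i.+1 ->
  (forall L, A L -> se_labels (def S L) `<=` A) ->
  correct_typing G S t ->
  (forall n L, A L -> strat st L <= i -> t (n, L) <-> Typing G st (n, L)) ->
  restrict_typing t A `<=` Typing G st.
Proof.
move=> ik Ai Acl ct tT.
set T := Typing G st; set Ti := restrict_typing T (strata_upto st i.+1).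
set tA := restrict_typing t A.
have TiE : Ti = stratum_typing G st i.+1 by exact: restrict_stratum_typing.
(* The union of [Ti] and [tA] is shown to be a candidate for stratum [i.+1]. By [FT] it adds nothing
   to [Ti] up to stratum [i], which settles both the negated labels and the constraint on lower
   strata. *)
pose F := [set u | u = Ti \/ u = tA].
have FT m L : strat st L <= i -> (\bigcup_(u in F) u) (m, L) -> Ti (m, L).
  move=> Li [u [->//|->] [tmL AL]].
  by split; [apply/(tT m L AL Li)|exact: Ai].
have Fc u : F u -> correct_typing G (restrict_schema st i.+1) u.
  case=> ->; first by rewrite TiE; exact: (proj1 (stratum_typing_correct _)).
  exact: restrict_correct_typing.
have Fcorrect :
    correct_typing G (restrict_schema st i.+1) (\bigcup_(u in F) u).
  apply: bigcup_correct_typing => // u n L m L' Fu unL nL' FmL'.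
  have [_ [SL Li]] := proj1 (Fc _ Fu) _ unL.
  have [SL' L'L] := strat_negated SL nL'.
  have L'i : strat st L' <= i by rewrite -ltnS; exact: leq_trans L'L Li.
  have TmL' := FT _ _ L'i FmL'.
  case: Fu unL => -> // -[_ AL].
  have AL' : A L' by apply: (Acl _ AL); exact: negated_labels_sub.
  by split=> //; apply/(tT m L' AL' L'i); case: TmL'.
suff FTi : \bigcup_(u in F) u `<=` Ti.
  by move=> nL tnL; have [] : Ti nL by apply: FTi; exists tA => //; right.
rewrite TiE stratum_typingS => nL FnL; exists (\bigcup_(u in F) u) => //.
split=> //; rewrite -(restrict_stratum_typing (ltnW ik)).
apply/seteqP; split=> -[n L] [].
  by move=> H [SL Li]; split=> //; case: (FT _ _ Li H).
move=> TnL [SL Li]; split=> //; exists Ti; first by left.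
by split=> //; split=> //; exact: leqW.
Qed.

End Strata.

(** * Comparison of two stratifications *)

Lemma Typing_sub_step (IRI Lit Blank Label : Type)
    (S : schema IRI Lit Label) (G : graph IRI Lit Blank)
    (hS : valid_schema S) (st1 st2 : stratification S) (L : Label) :
  (forall n L', labels S L' ->
     strat st1 L' + strat st2 L' < strat st1 L + strat st2 L ->
     Typing G st1 (n, L') <-> Typing G st2 (n, L')) ->
  forall n, labels S L -> Typing G st2 (n, L) -> Typing G st1 (n, L).
Proof.
move=> IH n SL TnL; have /andP[L_gt0 Lk] := strat_range st1 SL.
pose A := strata_upto st1 (strat st1 L) `&` strata_upto st2 (strat st2 L).
apply: (@Typing_maximal _ _ _ _ G S hS st1 (Typing G st2) A (strat st1 L).-1).
- by rewrite prednK.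
- by rewrite prednK // => L' [].
- by move=> L' [A1 A2] L'' eL''; split; exact: strata_upto_closed eL''.
- exact: Typing_correct.
(* The first stratum number drops strictly and membership in [A] bounds the second, so the sum
   drops. *)
- move=> m L' [[SL' _] [_ L'2]] L'1; apply: iff_sym; apply: IH => //.
  by rewrite -addSn leq_add // -(prednK L_gt0) ltnS.
- by [].
Qed.

Theorem lemma2 (IRI Lit Blank Label : Type)
    (S : schema IRI Lit Label) (G : graph IRI Lit Blank)
    (hS : valid_schema S) (strat1 strat2 : stratification S) :
  Typing G strat1 = Typing G strat2.
Proof.
(* The bound [d] turns plain induction into strong induction on the sum of the two stratum
   numbers. *)
suff agree d L n : strat strat1 L + strat strat2 L < d -> labels S L ->
    Typing G strat1 (n, L) <-> Typing G strat2 (n, L).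
  apply/seteqP; split=> -[n L] TnL.
    have [_ SL] := proj1 (Typing_correct G hS strat1) _ TnL.
    exact/(agree _ L n (ltnSn _) SL).
  have [_ SL] := proj1 (Typing_correct G hS strat2) _ TnL.
  exact/(agree _ L n (ltnSn _) SL).
elim: d L n => // d IH L n Ld SL.
have IHL m L' : labels S L' ->
    strat strat1 L' + strat strat2 L' < strat strat1 L + strat strat2 L ->
    Typing G strat1 (m, L') <-> Typing G strat2 (m, L').
  by move=> SL' L'L; apply: IH => //; exact: leq_trans L'L _.
split; apply: Typing_sub_step => // m L' SL' L'L.
by apply: iff_sym; apply: IHL => //; rewrite addnC [ltnRHS]addnC.
Qed.
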